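(* For any $m,n\ge2$, the homogeneous components $c_{A,m}(n)$ of the Abel series over $X=\{x_1,\ldots,x_m\}$ satisfy $$c_{A,m}(n)=c_{A,m}(n-1)\sqcup\!\sqcup x_1+\sum_{i=2}^m\ \sum_{k_1+\cdots+k_i=n-1}c_{A,m}(k_1)\sqcup\!\sqcup\Big(x_i\big(c_{A,m}(k_2)\sqcup\!\sqcup\cdots\sqcup\!\sqcup c_{A,m}(k_i)\big)\Big),$$ where the inner sum is over positive integers $k_1,\ldots,k_i$.
   Context: The polynomials $c_{A,m}(n)$ in the noncommuting letters $x_1,\ldots,x_m$ are defined by $c_{A,m}(n)=0$ for $n<1$, $c_{A,m}(1)=1$ (the empty word $\mathrm{e}$ with coefficient $1$), and $c_{A,m}(n)=\sum_{i=1}^m(n-i)\,c_{A,m}(n-i)\,x_i$ for $n\ge2$ (concatenation with $x_i$ on the right). With $\deg(x_i)=i$, $c_{A,m}(n)$ is the homogeneous component of degree $n-1$ of the Abel series $c_{A,m}=\sum_{n\ge1}c_{A,m}(n)$, which is the generating series of the solution of $\dot z=\sum_{i=1}^mv_iz^{i+1}$, $z(0)=1$. The shuffle product $\sqcup\!\sqcup$ is the bilinear product determined on words by $(x_i\eta)\sqcup\!\sqcup(x_j\xi)=x_i(\eta\sqcup\!\sqcup(x_j\xi))+x_j((x_i\eta)\sqcup\!\sqcup\xi)$ and $\eta\sqcup\!\sqcup\mathrm{e}=\mathrm{e}\sqcup\!\sqcup\eta=\eta$. The expression $x_i(\cdot)$ is concatenation with $x_i$ on the left. *)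

(* Defs.v *)
From HB Require Import structures.
From mathcomp Require Import all_boot all_order all_algebra.
From mathcomp Require Import finmap.
From mathcomp Require Import monalg.

Set Implicit Arguments.
Unset Strict Implicit.
Unset Printing Implicit Defensive.

Import GRing.Theory.
Local Open Scope ring_scope.

(* Noncommutative polynomials R<x_1, ..., x_m>, as the monoid algebra of the
   free monoid on 'I_m: the product *%R is concatenation, 1 is the empty word.
   The letter indexed by i : 'I_m is x_(i+1), of degree i+1. *)
Notation ncpoly R m := {malg R[fmonom 'I_m]}.

Section Abel.
Variables (R : comNzRingType) (m : nat).

Definition word (u : seq 'I_m) : ncpoly R m := << FMonom u >>.
Definition letter (i : 'I_m) : ncpoly R m := word [:: i].

Fixpoint shuffle_word (u : seq 'I_m) : seq 'I_m -> ncpoly R m :=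
  if u is i :: u' then
    fix shuffle_u v :=
      if v is j :: v' then
        letter i * shuffle_word u' v + letter j * shuffle_u v'
      else word u
  else word.

Definition shuffle (p q : ncpoly R m) : ncpoly R m :=
  \sum_(u <- msupp p) \sum_(v <- msupp q) (p@_u * q@_v) *: shuffle_word u v.

(* [abel_rec N n] is the n-th component as soon as n <= N; see [abelE] for the
   defining recurrence. *)
Fixpoint abel_rec (N n : nat) : ncpoly R m :=
  if N is N'.+1 then
    if n == 1%N then 1
    else \sum_(i < m) (n - i.+1)%:R *: (abel_rec N' (n - i.+1) * letter i)
  else 0.

Definition abel (n : nat) : ncpoly R m := abel_rec n n.

Lemma shuffle_wordE i u j v :
  shuffle_word (i :: u) (j :: v) =
    letter i * shuffle_word u (j :: v) + letter j * shuffle_word (i :: u) v.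
Proof. by []. Qed.

Lemma shuffle_word0l v : shuffle_word [::] v = word v.
Proof. by []. Qed.

Lemma shuffle_word0r u : shuffle_word u [::] = word u.
Proof. by case: u. Qed.

Lemma shuffleEw (d e : {fset fmonom 'I_m}) p q :
    (msupp p `<=` d)%fset -> (msupp q `<=` e)%fset ->
  shuffle p q = \sum_(u <- d) \sum_(v <- e) (p@_u * q@_v) *: shuffle_word u v.
Proof.
move=> pd qe; rewrite /shuffle (big_fset_incl _ pd) => [|u _ /mcoeff_outdom pu].
  apply: eq_bigr => u _; apply: big_fset_incl => // v _ /mcoeff_outdom qv.
  by rewrite qv mulr0 scale0r.
by rewrite big1 // => v _; rewrite pu mul0r scale0r.
Qed.

Lemma shuffle_words u v : shuffle (word u) (word v) = shuffle_word u v.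
Proof.
by rewrite /shuffle !msuppU oner_eq0 !big_seq_fset1 !mcoeffUU mulr1 scale1r.
Qed.

Lemma shuffle_linearl a p1 p2 q :
  shuffle (a *: p1 + p2) q = a *: shuffle p1 q + shuffle p2 q.
Proof.
pose d := (msupp p1 `|` msupp p2 `|` msupp (a *: p1 + p2))%fset.
have d1 : (msupp p1 `<=` d)%fset by rewrite /d -fsetUA fsubsetUl.
have d2 : (msupp p2 `<=` d)%fset by rewrite /d fsetUAC fsubsetUr.
have d3 : (msupp (a *: p1 + p2) `<=` d)%fset by rewrite /d fsubsetUr.
have dq := fsubset_refl (msupp q).
rewrite (shuffleEw d1 dq) (shuffleEw d2 dq) (shuffleEw d3 dq).
rewrite scaler_sumr -big_split /=; apply: eq_bigr => u _.
rewrite scaler_sumr -big_split /=; apply: eq_bigr => v _.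
by rewrite mcoeffD mcoeffZ mulrDl scalerDl -mulrA scalerA.
Qed.

Lemma shuffle_linearr a p q1 q2 :
  shuffle p (a *: q1 + q2) = a *: shuffle p q1 + shuffle p q2.
Proof.
pose d := (msupp q1 `|` msupp q2 `|` msupp (a *: q1 + q2))%fset.
have d1 : (msupp q1 `<=` d)%fset by rewrite /d -fsetUA fsubsetUl.
have d2 : (msupp q2 `<=` d)%fset by rewrite /d fsetUAC fsubsetUr.
have d3 : (msupp (a *: q1 + q2) `<=` d)%fset by rewrite /d fsubsetUr.
have dp := fsubset_refl (msupp p).
rewrite (shuffleEw dp d1) (shuffleEw dp d2) (shuffleEw dp d3).
rewrite scaler_sumr -big_split /=; apply: eq_bigr => u _.
rewrite scaler_sumr -big_split /=; apply: eq_bigr => v _.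
by rewrite mcoeffD mcoeffZ mulrDr scalerDl scalerA mulrCA.
Qed.

Lemma abel0 : abel 0 = 0.
Proof. by []. Qed.

Lemma abel1 : abel 1 = 1.
Proof. by []. Qed.

Lemma abel_recS N n : abel_rec N.+1 n =
  if n == 1%N then 1
  else \sum_(i < m) (n - i.+1)%:R *: (abel_rec N (n - i.+1) * letter i).
Proof. by []. Qed.

Lemma abel_rec0 N : abel_rec N 0 = 0.
Proof.
by case: N => [|N] //; rewrite abel_recS big1 // => i _; rewrite sub0n scale0r.
Qed.

Lemma abel_recE N n : (n <= N)%N -> abel_rec N n = abel n.
Proof.
suff E M : (n <= N)%N -> (n <= M)%N -> abel_rec N n = abel_rec M n by move/E; apply.
elim: N n M => [|N IH] n M.
  by rewrite leqn0 => /eqP->; rewrite !abel_rec0.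
case: n => [|n]; first by rewrite !abel_rec0.
case: M => [|M]; first by rewrite ltn0.
rewrite !ltnS => nN nM.
rewrite (abel_recS N) (abel_recS M); case: (_ == _); first by [].
apply: eq_bigr => i _; rewrite subSS (IH (n - i)%N M); first by [].
  exact: leq_trans (leq_subr _ _) nN.
exact: leq_trans (leq_subr _ _) nM.
Qed.

Lemma abelE n : (2 <= n)%N ->
  abel n = \sum_(i < m) (n - i.+1)%:R *: (abel (n - i.+1) * letter i).
Proof.
case: n => [|[|n]] n_gt1; [discriminate n_gt1 | discriminate n_gt1 |].
rewrite {1}/abel abel_recS [_ == _]/=; apply: eq_bigr => i _.
by rewrite abel_recE ?subSS ?leq_subr.
Qed.

End Abel.

(* Main.v *)
(* Write c^r for the r-th shuffle power of the Abel series. Deleting a leading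
   letter is a derivation of the shuffle product and maps c to c^(i+1) when the
   letter is x_i. The component [abelpow r n] of c^r of degree n - r is therefore
   defined by its expansion in the first letter,
     abelpow r n = [r = n] + r * sum_i x_i (abelpow (r + i) n).
   This recursion keeps n fixed and increases r, and [abelpow r n] vanishes for
   r > n, which makes induction on n - r possible. In this way one gets the
   recurrence in the last letter (so that [abelpow 1] is the Abel series), the
   rule c^r c^s = c^(r+s), and c^(r+1) T = c^(r+1) - c^r for
   T = sum_i x_i c^(i-1). The case r = 0 of the last identity is the theorem. *)

Require Import Defs.
From HB Require Import structures.
From mathcomp Require Import all_boot all_order all_algebra.
From mathcomp Require Import finmap.
From mathcomp Require Import monalg zify.

Import GRing.Theory.
Local Open Scope ring_scope.

(* [shf] and [lcons] are locked because unification would otherwise unfold the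
   product of the monoid algebra, which makes rewriting intractable. *)
HB.lock Definition shf (R : comNzRingType) (m : nat) (p q : ncpoly R m) :
  ncpoly R m := shuffle p q.
HB.lock Definition lcons (R : comNzRingType) (m : nat) (i : 'I_m)
  (p : ncpoly R m) : ncpoly R m := letter R i * p.

(* Carries the linear structure of [shf] in its left argument. *)
Definition shfr {R : comNzRingType} {m : nat} (q p : ncpoly R m) := shf R m p q.

Arguments shf {R m} p q.
Arguments lcons {R m} i p.

(** * Bilinearity of the shuffle product and its recursion on polynomials *)

Section Shuffle.
Context {R : comNzRingType} {m : nat}.
Implicit Types (p q : ncpoly R m) (i j : 'I_m).

Lemma shf_linearr p : linear (shf p).
Proof. by move=> a q1 q2; rewrite shf.unlock shuffle_linearr. Qed.

HB.instance Definition _ p :=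
  GRing.isLinear.Build R (ncpoly R m) (ncpoly R m) _ (shf p) (shf_linearr p).

Lemma shf_linearl q : linear (shfr q).
Proof. by move=> a p1 p2; rewrite /shfr shf.unlock shuffle_linearl. Qed.

HB.instance Definition _ q :=
  GRing.isLinear.Build R (ncpoly R m) (ncpoly R m) _ (shfr q) (shf_linearl q).

Lemma lcons_linear i : linear (lcons (R := R) i).
Proof.
move=> a p q; rewrite lcons.unlock mulrDr; congr (_ + _).
(* A constant is a multiple of the empty word, so it commutes with every letter. *)
have letterC : letter R i * a%:MP = a%:MP * letter R i.
  apply: (etrans (fgmulUU _ _ _ _)); apply/esym.
  by apply: (etrans (fgmulUU _ _ _ _)); rewrite mulr1 mul1r mulm1 mul1m.
rewrite -(mul_malgC a p) (mulrA (letter R i) a%:MP p) letterC.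
by rewrite -(mulrA a%:MP (letter R i) p); exact: mul_malgC.
Qed.

HB.instance Definition _ i :=
  GRing.isLinear.Build R (ncpoly R m) (ncpoly R m) _ (lcons i) (lcons_linear i).

Lemma shf0l q : shf 0 q = 0.
Proof. exact: (linear0 (shfr q)). Qed.

Lemma shfDl p1 p2 q : shf (p1 + p2) q = shf p1 q + shf p2 q.
Proof. exact: (linearD (shfr q)). Qed.

Lemma shfMnl p q n : shf (p *+ n) q = shf p q *+ n.
Proof. exact: (linearMn (shfr q)). Qed.

Lemma shf_suml I (r : seq I) (P : pred I) (F : I -> ncpoly R m) q :
  shf (\sum_(k <- r | P k) F k) q = \sum_(k <- r | P k) shf (F k) q.
Proof. exact: (linear_sum (shfr q)). Qed.

Lemma word0 : word R [::] = 1 :> ncpoly R m.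
Proof. by rewrite /word -fmoneE. Qed.

Lemma lcons_word i (u : seq 'I_m) : lcons i (word R u) = word R (i :: u).
Proof.
rewrite lcons.unlock; apply: (etrans (fgmulUU _ _ _ _)); rewrite mulr1.
by congr (<< _ *g _ >>); apply/eqP; rewrite fmP fmM.
Qed.

Lemma shf_word_lcons i (u : seq 'I_m) j (v : seq 'I_m) :
  shf (lcons i (word R u)) (lcons j (word R v)) =
    lcons i (shf (word R u) (lcons j (word R v)))
    + lcons j (shf (lcons i (word R u)) (word R v)).
Proof.
by rewrite !lcons_word shf.unlock !shuffle_words shuffle_wordE lcons.unlock.
Qed.

(** Reduces identities that are linear in [p] to the case of words. *)
Lemma ncpoly_ind (P : ncpoly R m -> Prop) :
    (forall (a : R) p q, P p -> P q -> P (a *: p + q)) -> P 0 ->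
  (forall u, P (word R u)) -> forall p, P p.
Proof.
move=> Plin P0 Pword p; rewrite [p]monalgE; elim/big_rec: _ => // u q _ Pq.
have -> : << p@_u *g u >> = p@_u *: word R u.
  by apply/malgP => w; rewrite mcoeffZ !mcoeffU fmK mulr_natr.
exact: Plin.
Qed.

Lemma shf1p q : shf 1 q = q.
Proof.
elim/ncpoly_ind: q => [a p q Hp Hq||u]; last 1 first.
- by rewrite -word0 shf.unlock shuffle_words shuffle_word0l.
- by rewrite shf_linearr Hp Hq.
- by rewrite linear0.
Qed.

Lemma shfp1 p : shf p 1 = p.
Proof.
elim/ncpoly_ind: p => [a p q Hp Hq||u]; last 1 first.
- by rewrite -word0 shf.unlock shuffle_words shuffle_word0r.
- by rewrite -/(shfr 1 _) shf_linearl /shfr Hp Hq.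
- by rewrite shf0l.
Qed.

Lemma shf_lcons i p j q :
  shf (lcons i p) (lcons j q) =
    lcons i (shf p (lcons j q)) + lcons j (shf (lcons i p) q).
Proof.
elim/ncpoly_ind: p => [a p1 p2 H1 H2||u].
- rewrite -!/(shfr _ _) !linearP /= /shfr H1 H2.
  by rewrite scalerDr addrACA.
- by rewrite !(linear0, shf0l) addr0.
elim/ncpoly_ind: q => [a q1 q2 H1 H2||v].
- rewrite !linearP /= H1 H2.
  by rewrite scalerDr addrACA.
- by rewrite !linear0 addr0.
exact: shf_word_lcons.
Qed.

(** The Leibniz rule for deleting a leading letter: [P i] and [Q i] are what remains of [p] and [q]
    after the letter [i]. *)
Lemma shf_sum_lcons (a b : nat) (P Q : 'I_m -> ncpoly R m) :
  let p := 1 *+ a + \sum_i lcons i (P i) in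
  let q := 1 *+ b + \sum_i lcons i (Q i) in
  shf p q =
    1 *+ (a * b) + \sum_i lcons i (shf (P i) q + shf p (Q i)).
Proof.
move=> p q; pose P' := \sum_i lcons i (P i); pose Q' := \sum_i lcons i (Q i).
have PQ : shf P' Q' =
    \sum_i lcons i (shf (P i) Q' + shf P' (Q i)).
  under [RHS]eq_bigr do rewrite linearD.
  rewrite big_split /= {1}/P' shf_suml.
  transitivity (\sum_i \sum_j
      (lcons i (shf (P i) (lcons j (Q j)))
       + lcons j (shf (lcons i (P i)) (Q j)))).
    apply: eq_bigr => i _; rewrite linear_sum; apply: eq_bigr => j _.
    exact: shf_lcons.
  under [LHS]eq_bigr do rewrite big_split /=.
  rewrite big_split /=; congr (_ + _).
    by apply: eq_bigr => i _; rewrite !linear_sum.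
  rewrite exchange_big; apply: eq_bigr => j _.
  by rewrite shf_suml linear_sum.
rewrite {1}/p {1}/q -/P' -/Q' shfDl !linearD /= PQ.
rewrite !shfMnl !linearMn /= !shf1p !shfp1 -mulrnA mulnC -addrA.
congr (_ + _); rewrite {1}/P' {1}/Q' -!sumrMnl -!big_split /=.
apply: eq_bigr => i _.
rewrite /p /q -/P' -/Q' shfDl !linearD /= shfMnl !linearMn /= shf1p shfp1.
by rewrite [RHS]addrACA addrA; congr (_ + _); exact: addrC.
Qed.
End Shuffle.

(** * Shuffle powers of the Abel series *)

Section AbelPowers.
Context {R : comNzRingType} {m : nat}.

(* [d] is fuel: the value no longer depends on it once [n < r + d]. *)
Fixpoint abelpow_rec (d r n : nat) : ncpoly R m :=
  if d is d'.+1 then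
    1 *+ (r == n) + \sum_(i < m) lcons i (abelpow_rec d' (r + i.+1) n *+ r)
  else 0.

(** The fuel [n.+1 - r] is the least [d] with [n < r + d]. *)
Definition abelpow r n := abelpow_rec (n.+1 - r) r n.

Lemma abelpow_rec_gt d r n : (n < r)%N -> abelpow_rec d r n = 0.
Proof.
elim: d r => //= d IHd r nr; rewrite gtn_eqF // add0r big1 // => i _.
by rewrite IHd ?mul0rn ?linear0 // (leq_trans nr) // leq_addr.
Qed.

Lemma abelpow_gt r n : (n < r)%N -> abelpow r n = 0.
Proof. exact: abelpow_rec_gt. Qed.

Lemma abelpow_recE d r n : (n < r + d)%N -> abelpow_rec d r n = abelpow r n.
Proof.
suff E e : (n < r + d)%N -> (n < r + e)%N ->
    abelpow_rec d r n = abelpow_rec e r n.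
  by move/E; apply; rewrite -leq_subLR.
elim: d r e => [|d IHd] r [|e] rd re //.
- by rewrite !abelpow_rec_gt //; lia.
- by rewrite !abelpow_rec_gt //; lia.
congr (_ + _); apply: eq_bigr => i _; congr (lcons i (_ *+ r)).
by apply: IHd; lia.
Qed.

Lemma abelpowE r n :
  abelpow r n =
    1 *+ (r == n) + \sum_(i < m) lcons i (abelpow (r + i.+1) n *+ r).
Proof.
rewrite -(abelpow_recE n.+1) ?leq_addl //=; congr (_ + _).
apply: eq_bigr => i _; congr (lcons i (_ *+ r)).
by apply: abelpow_recE; lia.
Qed.

Lemma shf_abelpow r a s b :
  shf (abelpow r a) (abelpow s b) =
    1 *+ ((r == a) && (s == b))
    + \sum_(i < m) lcons i (shf (abelpow (r + i.+1) a) (abelpow s b) *+ r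
                            + shf (abelpow r a) (abelpow (s + i.+1) b) *+ s).
Proof.
rewrite {1}[abelpow r a]abelpowE {1}[abelpow s b]abelpowE.
rewrite shf_sum_lcons -!abelpowE mulnb; congr (_ + _).
by apply: eq_bigr => i _; rewrite shfMnl linearMn.
Qed.

(** Induction on a bound for [n - (r + s)]: deleting the leading letter [i] leaves [r] copies of one
    sum and [s] copies of another, and both sums equal [abelpow (r + s + i.+1) n] by induction. *)
Lemma abelpowD r s n :
  \sum_(a < n.+1) shf (abelpow r a) (abelpow s (n - a)) = abelpow (r + s) n.
Proof.
have [d] : {d | n < r + s + d}%N by exists n.+1; rewrite leq_addl.
elim: d r s => [|d IHd] r s nrs.
  rewrite addn0 in nrs; rewrite (abelpow_gt _ _ nrs) big1 // => a _.
  have [ar|ra] := ltnP a r; first by rewrite (abelpow_gt _ _ ar) shf0l.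
  by rewrite (abelpow_gt s) ?linear0 //; have := ltn_ord a; lia.
under eq_bigr do rewrite shf_abelpow.
rewrite big_split /= exchange_big /= [RHS]abelpowE; congr (_ + _).
  rewrite sumrMnr; congr (_ *+ _).
  (* Only [a = r] contributes to the empty word, and then [s = n - a] reads [r + s = n]. *)
  transitivity (\sum_(a < n.+1 | a == r :> nat) (r + s == n))%N.
    rewrite [RHS]big_mkcond; apply: eq_bigr => a _ /=.
    rewrite eq_sym; case: eqP => //= ar; congr nat_of_bool.
    by have := ltn_ord a; lia.
  by rewrite (big_ord1_eq _ (fun=> nat_of_bool _)); case: ifP => //; lia.
apply: eq_bigr => i _; rewrite -linear_sum; congr (lcons i _).
rewrite big_split /= !sumrMnl mulrnDr !IHd.
- by rewrite addnAC addnA.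
- by lia.
- by lia.
Qed.

(* The identity c^(r+1) T + c^r = c^(r+1), in degree n - r. *)
Lemma shf_lcons_abelpow r n :
  \sum_(i < m) \sum_(a < n.+1) shf (abelpow r.+1 a) (lcons i (abelpow i (n - a)))
    + abelpow r n = abelpow r.+1 n.+1.
Proof.
rewrite exchange_big /=.
(* The zero constant term gives [T] the shape that [shf_sum_lcons] expects. *)
pose T b := 1 *+ 0 + \sum_(i < m) lcons i (abelpow i b).
transitivity (\sum_(a < n.+1) shf (abelpow r.+1 a) (T (n - a)%N) + abelpow r n).
  by congr (_ + _); apply: eq_bigr => a _; rewrite /T mulr0n add0r linear_sum.
have [d] : {d | n < r + d}%N by exists n.+1; rewrite leq_addl.
elim: d r => [|d IHd] r nr.
  rewrite addn0 in nr; rewrite !abelpow_gt // addr0 big1 // => a _.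
  by rewrite abelpow_gt ?shf0l //; have := ltn_ord a; lia.
transitivity (abelpow r n + \sum_(j < m) lcons j
    ((\sum_(a < n.+1) shf (abelpow (r + j.+1).+1 a) (T (n - a)%N)) *+ r.+1
     + abelpow (r.+1 + j) n)).
  rewrite addrC; congr (_ + _).
  transitivity (\sum_(a < n.+1) \sum_(j < m) lcons j
    (shf (abelpow (r + j.+1).+1 a) (T (n - a)%N) *+ r.+1
     + shf (abelpow r.+1 a) (abelpow j (n - a)))).
    apply: eq_bigr => a _; rewrite {1}[abelpow r.+1 a]abelpowE.
    rewrite shf_sum_lcons muln0 mulr0n add0r -abelpowE; apply: eq_bigr => j _.
    by rewrite shfMnl addSn.
  rewrite exchange_big; apply: eq_bigr => j _ /=.
  by rewrite -linear_sum big_split /= sumrMnl abelpowD.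
rewrite [RHS]abelpowE [abelpow r n]abelpowE eqSS -addrA; congr (_ + _).
rewrite -big_split /=; apply: eq_bigr => j _.
rewrite -linearD; congr (lcons j _) => /=.
(* The term [abelpow (r.+1 + j) n], left by [T], joins the [r] copies coming from [abelpow r n] to
   make the [r.+1] copies that the induction hypothesis absorbs. *)
rewrite addSn -[abelpow (r + j.+1).+1 n.+1]IHd; last first.
  by lia.
by rewrite mulrnDl addnS addrCA -mulrSr.
Qed.

(** * Recurrence in the last letter *)

Lemma lcons_mul i p q : lcons i p * q = lcons i (p * q) :> ncpoly R m.
Proof. by rewrite lcons.unlock mulrA. Qed.

(** Expand in the first letter, apply induction to the last letter of what remains, exchange the two
    sums, and fold the first-letter expansion back. *)
Lemma abelpow_rightE r n :
  abelpow r n = 1 *+ (r == n) +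
    \sum_(i < m) (abelpow r (n - i.+1) * letter R i) *+ (n - i.+1).
Proof.
have [d] : {d | n < r + d}%N by exists n.+1; rewrite leq_addl.
elim: d r => [|d IHd] r nr.
  rewrite addn0 in nr; rewrite abelpow_gt // gtn_eqF // add0r big1 // => i _.
  by rewrite abelpow_gt ?mul0r ?mul0rn //; lia.
rewrite [LHS]abelpowE; congr (_ + _).
transitivity (\sum_(i < m) lcons i (1 *+ (r == n - i.+1)%N) *+ (n - i.+1)%N
  + \sum_(i < m) \sum_(j < m) lcons i
    (abelpow (r + i.+1) (n - j.+1) * letter R j) *+ (n - j.+1) *+ r).
  rewrite -big_split; apply: eq_bigr => i _ /=.
  rewrite IHd; last first.
    by lia.
  rewrite mulrnDl linearD; congr (_ + _); last first.
    rewrite -sumrMnl linear_sum; apply: eq_bigr => j _.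
    by rewrite !linearMn.
  (* Both multiplicities vanish unless [n = r + i.+1], where [r = n - i.+1]; if [n < i.+1],
     truncated subtraction makes the right one zero. *)
  rewrite -mulrnA -linearMn -mulrnA; congr (lcons i (1 *+ _)); lia.
rewrite [X in _ + X]exchange_big -big_split /=; apply: eq_bigr => j _.
rewrite [abelpow r _]abelpowE mulrDl mulrnDl; congr (_ + _).
  by rewrite lcons.unlock mulr_natl mulr_natr.
rewrite mulr_suml -sumrMnl; apply: eq_bigr => i _.
by rewrite lcons_mul mulrnAl linearMn mulrnAC.
Qed.

Lemma abelpow1 n : abelpow 1 n = abel R m n.
Proof.
elim/ltn_ind: n => [[|[|n]]] IHn.
- by rewrite abel0 abelpow_gt.
- by rewrite abel1 abelpow_rightE big1 ?addr0.
rewrite abelE // abelpow_rightE add0r; apply: eq_bigr => i _.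
by rewrite IHn ?scaler_nat // subSS ltnS leq_subr.
Qed.

(** * Sums over compositions *)

Lemma sum_ffun_ordS (T : finType) (V : nmodType) (i : nat)
    (F : T -> {ffun 'I_i -> T} -> V) :
  \sum_(k : {ffun 'I_i.+1 -> T}) F (k ord0) [ffun j => k (lift ord0 j)] =
    \sum_(a : T) \sum_(k : {ffun 'I_i -> T}) F a k.
Proof.
rewrite pair_big /=.
pose cons (ak : T * {ffun 'I_i -> T}) : {ffun 'I_i.+1 -> T} :=
  [ffun j => if unlift ord0 j is Some j' then ak.2 j' else ak.1].
have head ak : cons ak ord0 = ak.1 by rewrite ffunE unlift_none.
have tail ak : [ffun j => cons ak (lift ord0 j)] = ak.2.
  by apply/ffunP => j; rewrite !ffunE liftK.
rewrite (reindex cons) /=.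
  by apply: eq_bigr => ak _; rewrite head tail.
exists (fun k => (k ord0, [ffun j => k (lift ord0 j)])) => [[a k]|k] _.
  by rewrite head tail.
apply/ffunP => j; rewrite ffunE; case: unliftP => [j'|] -> //=.
by rewrite ffunE.
Qed.

(** Splits the first part off a composition. The map [L] is the identity when powers are built up,
    and left concatenation with a letter in the recurrence. *)
Lemma sum_abelpow_split (L : {linear ncpoly R m -> ncpoly R m}) i n N
    (F : {ffun 'I_i -> 'I_n} -> ncpoly R m) :
    (forall M, (M < n)%N ->
      \sum_(k : {ffun 'I_i -> 'I_n} | (\sum_j k j == M)%N) F k = abelpow i M) ->
    (N < n)%N ->
  \sum_(k : {ffun 'I_i.+1 -> 'I_n} | (\sum_j k j == N)%N)
    shf (abelpow 1 (k ord0)) (L (F [ffun j => k (lift ord0 j)])) =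
  \sum_(a < N.+1) shf (abelpow 1 a) (L (abelpow i (N - a))).
Proof.
move=> FE Nn; rewrite big_mkcond /=.
(* The constraint couples head and tail, so it moves into the summand before they are separated. *)
pose G (a : 'I_n) (k : {ffun 'I_i -> 'I_n}) :=
  if (a + \sum_j k j == N)%N then shf (abelpow 1 a) (L (F k)) else 0.
transitivity (\sum_(k : {ffun 'I_i.+1 -> 'I_n})
    G (k ord0) [ffun j => k (lift ord0 j)]).
  apply: eq_bigr => k _; rewrite /G big_ord_recl.
  by under [in RHS]eq_bigr do rewrite ffunE.
rewrite sum_ffun_ordS.
rewrite (big_ord_widen _ (fun a => shf (abelpow 1 a) (L (abelpow i (N - a)))) Nn).
rewrite [RHS]big_mkcond; apply: eq_bigr => a _ /=.
case: ltnP => aN; last first.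
  by rewrite big1 // => k _; rewrite /G; case: eqP => // ?; lia.
rewrite -(FE (N - a)%N) ?linear_sum; last by lia.
rewrite [RHS]big_mkcond.
by apply: eq_bigr => k _; rewrite /G; congr (if _ then _ else _); lia.
Qed.

(** Iterates [abelpowD] one factor at a time; as [N < n], the range ['I_n] cuts off no composition
    of [N]. *)
Lemma sum_prod_abelpow i n N :
    (N < n)%N ->
  \sum_(k : {ffun 'I_i -> 'I_n} | (\sum_j k j == N)%N)
    \big[shf/1]_(j < i) abelpow 1 (k j) = abelpow i N.
Proof.
elim: i N => [|i IHi] N Nn.
  rewrite abelpowE [X in _ + X]big1 => [|j _]; last by rewrite mulr0n linear0.
  rewrite addr0 (eq_big (fun=> 0 == N)%N (fun=> 1)) => [|k|k _]; first last.
  - by rewrite big_ord0.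
  - by rewrite big_ord0.
  case: (0 == N)%N; last by rewrite big_pred0.
  by rewrite sumr_const card_ffun !card_ord.
rewrite -add1n -abelpowD -(sum_abelpow_split idfun _ _ _ _ IHi Nn).
apply: eq_bigr => k _; rewrite big_ord_recl; congr (shf _ _).
by apply: eq_bigr => j _; rewrite ffunE.
Qed.

Lemma big_shf_eq0 i (F : 'I_i -> ncpoly R m) j :
  F j = 0 -> \big[shf/1]_(j < i) F j = 0.
Proof.
elim: i F j => [|i IHi] F j; first by case: j.
rewrite big_ord_recl; case: (unliftP ord0 j) => [j' ->|->] Fj0.
  by rewrite (IHi _ j') // linear0.
by rewrite Fj0 shf0l.
Qed.

Lemma sum_compositions (x : 'I_m) i n N :
    (N < n)%N ->
  \sum_(k : {ffun 'I_i.+1 -> 'I_n}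
         | [forall j, (1 <= k j)%N] && (\sum_j k j == N)%N)
    shf (abel R m (k ord0))
        (lcons x (\big[shf/1]_(j < i) abel R m (k (lift ord0 j)))) =
  \sum_(a < N.+1) shf (abelpow 1 a) (lcons x (abelpow i (N - a))).
Proof.
move=> Nn.
rewrite -(sum_abelpow_split (lcons x) _ _ _ _ (fun M => sum_prod_abelpow i n M) Nn).
rewrite big_mkcondl; apply: eq_bigr => k _ /=.
have -> : \big[shf/1]_(j < i) abelpow 1 ([ffun j => k (lift ord0 j)] j) =
    \big[shf/1]_(j < i) abel R m (k (lift ord0 j)).
  by apply: eq_bigr => j _; rewrite ffunE abelpow1.
(* A tuple with a zero part contributes zero, because [abel R m 0] is zero. *)
rewrite abelpow1; case: ifPn => // /forallPn[j]; rewrite -leqNgt leqn0 => /eqP kj.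
case: (unliftP ord0 j) => [j' jE|jE]; rewrite jE in kj.
  by rewrite (big_shf_eq0 _ _ j') ?linear0 // kj.
by rewrite kj shf0l.
Qed.

End AbelPowers.

(** * Assembly of the recurrence *)

Theorem corollary2 (R : comNzRingType) (m n : nat)
    (hm : (2 <= m)%N) (hn : (2 <= n)%N) :
  abel R m n =
    shuffle (abel R m (n - 1)) (letter R (Ordinal (ltnW hm)))
    + \sum_(i < m | (2 <= i.+1)%N)
        \sum_(k : {ffun 'I_i.+1 -> 'I_n}
               | [forall j, (1 <= k j)%N] && (\sum_j k j == n - 1)%N)
          shuffle (abel R m (k ord0))
            (letter R i *
               \big[@shuffle R m/1]_(j < i) abel R m (k (lift ord0 j))).
Proof.
have abelpow0 b : abelpow 0 b = 1 *+ (0 == b) :> ncpoly R m.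
  by rewrite abelpowE big1 ?addr0 // => i _; rewrite mulr0n linear0.
have n1 : (n - 1 < n)%N by lia.
transitivity (abelpow 1 (n - 1).+1 : ncpoly R m).
  by rewrite abelpow1; congr (abel R m _); lia.
rewrite -shf_lcons_abelpow abelpow0 [(0 == _)%N]ltn_eqF; last by lia.
rewrite addr0 (bigD1 (Ordinal (ltnW hm))) //=; congr (_ + _).
  (* The letter x_1 has index 0 and so meets [abelpow 0], which is 1 in degree 0 and zero elsewhere:
     only [a = n - 1] survives. *)
  rewrite big_ord_recr /= subnn abelpow0 abelpow1 big1 ?add0r => [|a _].
    by rewrite shf.unlock lcons.unlock mulr1.
  by rewrite abelpow0 ltn_eqF ?linear0 // subn_gt0.
apply: eq_big => [i|i _]; first by rewrite -val_eqE /=; lia.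
rewrite -(sum_compositions i _ _ _ n1).
by rewrite shf.unlock lcons.unlock.
Qed.
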